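(* A $k$-translatable and left cancellative groupoid of order $n$ is alterable if and only if $[k^2]_n=n-1$, i.e. $k^2\equiv -1\pmod n$.
   Context: A groupoid is a set with a binary operation $\cdot$. It is left cancellative if $x\cdot y=x\cdot z$ implies $y=z$. It is alterable if for all elements $i,j,w,z$, $i\cdot j=w\cdot z$ implies $j\cdot w=z\cdot i$. For an integer $x$, $[x]_n$ denotes the residue of $x$ modulo $n$, represented in $\{1,\ldots,n\}$, with $0$ identified with $n$. All groupoids are finite and taken to be of the form $Q=\{1,\ldots,n\}$ with the natural ordering. For $1\le k<n$, $Q$ is $k$-translatable if in its multiplication table each row $i$, $2\le i\le n$, is obtained from row $i-1$ by cyclically shifting it $k$ places to the right, i.e. $i\cdot j=(i-1)\cdot[j-k]_n$ for all $j$ and all $2\le i\le n$. *)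

(* Defs.v *)
From mathcomp Require Import all_boot all_order all_algebra.

Set Implicit Arguments.
Unset Strict Implicit.
Unset Printing Implicit Defensive.

Local Open Scope ring_scope.

(* Left cancellation is injectivity in the right argument of the operation. *)
Definition left_cancellative (T : Type) (op : T -> T -> T) : Prop :=
  right_injective op.

Definition alterable (T : Type) (op : T -> T -> T) : Prop :=
  forall i j w z : T, op i j = op w z -> op j w = op z i.

(* [x]_n: the representative of x modulo n lying in {1, ..., n}, not in
   {0, ..., n-1}; see residue_bounds. *)
Definition residue (n : nat) (x : int) : nat :=
  if (x %% n%:Z)%Z == 0 then n else `|(x %% n%:Z)%Z|%N.

Lemma residue_bounds (n : nat) (x : int) :
  (0 < n)%N -> (0 < residue n x <= n)%N.
Proof.
move=> n_gt0; rewrite /residue; case: eqP => [_|/eqP r_neq0].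
  by rewrite n_gt0 leqnn.
have n_neq0 : n%:Z != 0 by rewrite -lt0n.
rewrite absz_gt0 r_neq0 ltnW // -ltz_nat gez0_abs ?modz_ge0 //.
by rewrite ltz_pmod.
Qed.

Lemma residue_mod (n : nat) (x : int) :
  (0 < n)%N -> ((residue n x)%:Z = x %[mod n%:Z])%Z.
Proof.
move=> n_gt0; rewrite /residue; case: eqP => [->|_]; first by rewrite modzz.
by rewrite gez0_abs ?modz_mod // modz_ge0 // -lt0n.
Qed.

(* The carrier {1, ..., n}, with the order inherited from nat. *)
Definition Q (n : nat) : Type := {x : nat | (0 < x <= n)%N}.

(* i' is i - 1 (so that 2 <= i <= n) and j' is [j - k]_n; by residue_bounds
   such i' and j' exist and are unique. *)
Definition translatable (n k : nat) (op : Q n -> Q n -> Q n) : Prop :=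
  forall i i' j j' : Q n,
    val i = (val i').+1 ->
    val j' = residue n ((val j)%:Z - k%:Z) ->
    op i j = op i' j'.

(* Main.v *)
Require Import Defs.
From mathcomp Require Import all_boot all_order all_algebra.
From mathcomp Require Import ring zify.

(** Translatability unrolls to the formula i * j = 1 * [j - k (i - 1)]_n: every
    row is the first row read along the linear form j - k i.  Left cancellation
    makes the first row injective, so the whole table is governed by that form:
    i * j = w * z holds exactly when j - k i = z - k w modulo n (lemma
    [eq_op_iff_eq_linear_form]).  Writing a = i - w and b = j - z, alterability
    then says that b = k a modulo n implies a = - k b modulo n.  If k ^ 2 = -1
    this follows on multiplying by k; conversely the solution a = 1, b = k
    gives k ^ 2 = -1.  *)

Import GRing.Theory Num.Theory.
Local Open Scope ring_scope.

Lemma eqz_modP (n : nat) (x y : int) :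
  (x = y %[mod n%:Z])%Z <-> exists q : int, x - y = q * n%:Z.
Proof.
split=> [/eqP|[q Hq]].
  by rewrite eqz_mod_dvd => /dvdzP.
by apply/eqP; rewrite eqz_mod_dvd; apply/dvdzP; exists q.
Qed.

Lemma residue_eqP (n : nat) (x y : int) :
  (0 < n)%N -> residue n x = residue n y <-> (x = y %[mod n%:Z])%Z.
Proof.
move=> n_gt0; split=> [Exy|Exy]; last by rewrite /residue Exy.
by rewrite -(residue_mod x n_gt0) Exy residue_mod.
Qed.

Lemma residue_id (n v : nat) : (0 < v <= n)%N -> residue n v%:Z = v.
Proof.
case/andP=> v_gt0; rewrite leq_eqVlt /residue => /orP[/eqP->|v_lt_n].
  by rewrite modzz.
by rewrite modz_small ?ltz_nat // eqz_nat eqn0Ngt v_gt0.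
Qed.

Lemma residueN1 (n : nat) : (1 < n)%N -> residue n (-1) = (n - 1)%N.
Proof.
move=> n_gt1; rewrite -[RHS](@residue_id n); last by lia.
apply/residue_eqP; first by lia.
by apply/eqz_modP; exists (-1); lia.
Qed.

Definition residueQ (n : nat) (n_gt0 : (0 < n)%N) (x : int) : Q n :=
  exist _ (residue n x) (residue_bounds x n_gt0).

Lemma residueQ_eqP (n : nat) (n_gt0 : (0 < n)%N) (x y : int) :
  residueQ n n_gt0 x = residueQ n n_gt0 y <-> (x = y %[mod n%:Z])%Z.
Proof.
split=> [/(congr1 val)|Exy]; first by move/residue_eqP => /(_ n_gt0).
by apply: val_inj; apply/residue_eqP.
Qed.

Lemma residueQ_val (n : nat) (n_gt0 : (0 < n)%N) (j : Q n) :
  residueQ n n_gt0 (val j)%:Z = j.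
Proof. by apply: val_inj; apply: residue_id (valP j). Qed.

Lemma translatable_first_row (n k : nat) (op : Q n -> Q n -> Q n)
    (n_gt0 : (0 < n)%N) (one : Q n) :
  translatable k op -> val one = 1%N ->
  forall i j : Q n,
    op i j = op one (residueQ n n_gt0 ((val j)%:Z - k%:Z * ((val i)%:Z - 1))).
Proof.
move=> htrans one1 i; have [m] := ubnP (val i).
elim: m i => // m IHm i lt_i_m j.
have /andP[i_gt0 i_le_n] := valP i.
have [i1|i_neq1] := eqVneq (val i) 1%N.
  have -> : i = one by apply: val_inj; rewrite one1.
  by rewrite one1 subrr mulr0 subr0 residueQ_val.
have pred_i_bounds : (0 < (val i).-1 <= n)%N by lia.
pose i' : Q n := exist _ (val i).-1 pred_i_bounds.
have val_i : val i = (val i').+1 by rewrite -(prednK i_gt0).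
rewrite (htrans i i' j (residueQ n n_gt0 ((val j)%:Z - k%:Z))) //.
rewrite IHm; last by rewrite -ltnS -val_i.
congr (op one _); apply/residueQ_eqP/eqz_modP.
have /eqz_modP[q Eq] := residue_mod ((val j)%:Z - k%:Z) n_gt0.
exists q; rewrite -Eq.
rewrite val_i -[(val i').+1]addn1 PoszD.
by ring.
Qed.

(** Both products are entries of the first row, which is injective; the shift
    k coming from the row index 1 occurs on both sides and cancels. *)
Lemma eq_op_iff_eq_linear_form (n k : nat) (op : Q n -> Q n -> Q n) :
  translatable k op -> left_cancellative op ->
  forall i j w z : Q n,
    op i j = op w z <->
    ((val j)%:Z - k%:Z * (val i)%:Z = (val z)%:Z - k%:Z * (val w)%:Z
       %[mod n%:Z])%Z.
Proof.
move=> htrans hcancel i j w z.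
have n_gt0 : (0 < n)%N by case/andP: (valP i) => /leq_trans; apply.
pose one : Q n := exist _ 1%N n_gt0.
have rowE := translatable_first_row n k op n_gt0 one htrans erefl.
rewrite (rowE i j) (rowE w z).
split=> [/hcancel/residueQ_eqP/eqz_modP[q Eq]|/eqz_modP[q Eq]].
  by apply/eqz_modP; exists q; rewrite -Eq; ring.
by congr (op one _); apply/residueQ_eqP/eqz_modP; exists q; rewrite -Eq; ring.
Qed.

Lemma alterable_iff_sqr_eqN1 (n k : nat) (op : Q n -> Q n -> Q n) :
  (1 <= k)%N -> (k < n)%N -> translatable k op -> left_cancellative op ->
  alterable op <-> (k%:Z ^+ 2 = -1 %[mod n%:Z])%Z.
Proof.
move=> k_gt0 lt_kn htrans hcancel.
have opP := eq_op_iff_eq_linear_form n k op htrans hcancel.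
split=> [halt|/eqz_modP[p Ep] i j w z].
  have b1 : (0 < 1 <= n)%N by lia.
  have b2 : (0 < 2 <= n)%N by lia.
  have bk : (0 < k <= n)%N by lia.
  have bn : (0 < n <= n)%N by lia.
  pose one : Q n := exist _ 1%N b1.
  pose two : Q n := exist _ 2%N b2.
  pose kQ : Q n := exist _ k bk.
  pose nQ : Q n := exist _ n bn.
  (* i = 2, w = 1, j = k and z = n, the representative of 0 in the carrier,
     realize i - w = 1 and j - z = k. *)
  have /halt/opP/= /eqz_modP[q Eq] : op two kQ = op one nQ.
    by apply/opP/eqz_modP; exists (-1) => /=; ring.
  by apply/eqz_modP; exists (k%:Z - q); rewrite mulrBl -Eq; ring.
move=> /opP/eqz_modP[q Eq]; apply/opP/eqz_modP.
exists (- k%:Z * q - p * ((val i)%:Z - (val w)%:Z)).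
have -> : (- k%:Z * q - p * ((val i)%:Z - (val w)%:Z)) * n%:Z
  = - k%:Z * (q * n%:Z) - p * n%:Z * ((val i)%:Z - (val w)%:Z) by ring.
by rewrite -Eq -Ep; ring.
Qed.

Theorem corollary2p18 (n k : nat) (op : Q n -> Q n -> Q n)
    (hk1 : (1 <= k)%N) (hkn : (k < n)%N)
    (htrans : translatable k op)
    (hcancel : left_cancellative op) :
  (alterable op <-> residue n (k%:Z ^+ 2) = (n - 1)%N) /\
  (residue n (k%:Z ^+ 2) = (n - 1)%N <-> (k%:Z ^+ 2 = -1 %[mod n%:Z])%Z).
Proof.
have n_gt1 : (1 < n)%N by exact: leq_ltn_trans hk1 hkn.
have residue_sqrP : residue n (k%:Z ^+ 2) = (n - 1)%N <->
    (k%:Z ^+ 2 = -1 %[mod n%:Z])%Z.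
  by rewrite -residueN1 //; apply: residue_eqP; apply: ltnW.
split=> //; rewrite residue_sqrP.
exact: alterable_iff_sqr_eqN1.
Qed.
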